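(* Let $p\ge 3$ be any odd integer and let $k=2p$. There is a $(2k+1)$-regular class $1$ graph $G$ such that $\phi_c(G)>2+\frac{2}{k}$.
   Context: Graphs are finite and may contain multiple edges but no loops. The chromatic index $\chi'(G)$ is the minimum $m$ such that $G$ has a proper $m$-edge-coloring (adjacent edges, including parallel edges, receive different colors). A graph $G$ with maximum degree $\Delta(G)$ is class $1$ if $\chi'(G)=\Delta(G)$ and class $2$ otherwise. For a real number $r\ge 2$, a nowhere-zero $r$-flow in $G$ is a pair $(D,f)$ where $D$ is an orientation of $G$ and $f\colon E(G)\to[1,r-1]$ is a function such that $\sum_{e\in E^+(v)}f(e)=\sum_{e\in E^-(v)}f(e)$ for every vertex $v$, where $E^+(v)$ and $E^-(v)$ are the sets of outgoing and incoming arcs at $v$. The circular flow number is $\phi_c(G)=\inf\{r : G \text{ has a nowhere-zero } r\text{-flow}\}$. *)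

(* Defs.v *)
From mathcomp Require Import all_boot all_order all_algebra.
From mathcomp Require Import boolp classical_sets reals ereal.

Set Implicit Arguments.
Unset Strict Implicit.
Unset Printing Implicit Defensive.

Import Order.TTheory GRing.Theory Num.Theory.

(* Finite loopless multigraphs: parallel edges are distinct elements of
   [edge] with the same two-element set of ends. *)
Record mgraph := MGraph {
  vertex : finType;
  edge : finType;
  ends : edge -> {set vertex};
  card_ends : forall e, #|ends e| = 2
}.

Definition degree (G : mgraph) (v : vertex G) : nat :=
  #|[set e : edge G | v \in ends e]|.

Definition max_degree (G : mgraph) : nat := \max_(v : vertex G) degree v.

Definition regular (d : nat) (G : mgraph) : Prop :=
  forall v : vertex G, degree v = d.

Definition adjacent_edges (G : mgraph) (e e' : edge G) : bool :=
  (e != e') && ~~ [disjoint ends e & ends e'].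

Definition proper_edge_coloring (G : mgraph) (m : nat)
    (c : {ffun edge G -> 'I_m}) : bool :=
  [forall e, forall e', adjacent_edges e e' ==> (c e != c e')].

Definition edge_colorable (G : mgraph) (m : nat) : bool :=
  [exists c : {ffun edge G -> 'I_m}, proper_edge_coloring c].

Lemma edge_colorable_ex (G : mgraph) : exists m, edge_colorable G m.
Proof.
exists #|edge G|; apply/existsP; exists [ffun e => enum_rank e].
apply/forallP => e; apply/forallP => e'; apply/implyP => /andP[nee' _].
by rewrite !ffunE (inj_eq enum_rank_inj).
Qed.

Definition chromatic_index (G : mgraph) : nat := ex_minn (edge_colorable_ex G).

Definition class1 (G : mgraph) : Prop := chromatic_index G = max_degree G.

(* An orientation: since [ends e] has two elements, the equation forces
   [arc_tail e] and [arc_head e] to be distinct. *)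
Record orientation (G : mgraph) := Orientation {
  arc_tail : edge G -> vertex G;
  arc_head : edge G -> vertex G;
  ends_orientation : forall e, ends e = [set arc_tail e; arc_head e]%SET
}.

Local Open Scope ring_scope.

Definition nowhere_zero_flow (R : realType) (r : R) (G : mgraph)
    (D : orientation G) (f : edge G -> R) : Prop :=
  (forall e, 1 <= f e <= r - 1) /\
  (forall v : vertex G,
     \sum_(e | arc_tail D e == v) f e = \sum_(e | arc_head D e == v) f e).

(* Valued in the extended reals: [+oo] when [G] has no nowhere-zero flow,
   i.e. when it has a bridge. *)
Definition circular_flow_number (R : realType) (G : mgraph) : \bar R :=
  ereal_inf [set r%:E | r in
    [set r : R | 2 <= r /\
       exists (D : orientation G) (f : edge G -> R),
         nowhere_zero_flow r D f]]%classic.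

(* Main.v *)
Require Import Defs.
From mathcomp Require Import all_boot all_order all_algebra.
From mathcomp Require Import boolp classical_sets reals ereal.
(* [finset] comes last because [classical_sets] shadows its lemma names. *)
From mathcomp Require Import fingroup perm finset zify lra.

Set Implicit Arguments.
Unset Strict Implicit.
Unset Printing Implicit Defensive.

Import Order.TTheory GRing.Theory Num.Theory.

Local Open Scope ring_scope.

(* Let n = 4p+1.  For an r-flow with r close to 2 + 1/p, let b(v) be the
   out-degree minus the in-degree of v in its orientation.  Comparing the flow
   through a cut with the number of its edges gives (2p+1) |b(X)| <= d(X) for
   every vertex set X; in an n-regular graph this forces b(v) = 1 or b(v) = -1.

   A union of n perfect matchings on a common vertex set is n-regular and of
   class 1, so it suffices to find n fixed-point-free involutions for which no
   such sign function b exists.  Take n terminals in cyclic order, a hub, and a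
   gadget of 4p vertices between consecutive terminals, with 2p edges to each
   of them; the last edge of each terminal goes to the hub.  Each gadget has
   boundary 4p, hence is balanced: 2p vertices of each sign.  As n is odd, two
   consecutive terminals have the same sign.  Let X consist of these two, the
   gadget between them, and the 2p vertices of their sign in each of the two
   gadgets next to them.  Then b(X) = 4p+2 up to sign, whereas d(X) is smaller
   than (2p+1)(4p+2) because no balanced cut of a gadget has more than
   4p^2+2p-1 inner edges: any two vertices of a gadget are adjacent, and the
   doubled edges contain a triangle, so that some doubled edge is uncut. *)

(** If [f] changed at every step, translation by [h] would exchange its two fibres, and [#|Z|] would
    be even. *)
Lemma odd_cycle_not_2colorable (Z : finZmodType) (h : Z) (f : Z -> bool) :
  odd #|Z| -> exists i, f (i + h) = f i.
Proof.
move=> oddZ; case: (pickP (fun i => f (i + h) == f i)) => [i /eqP fi|alt].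
  by exists i.
have bij_h : bijective (fun i : Z => i + h).
  by exists (fun i => i - h) => i; rewrite ?addrK ?subrK.
have cardE : (#|[pred i | f i]| + #|[pred i | f i]| = #|Z|)%N.
  rewrite -(cardC [pred i | f i]); congr (_ + _)%N.
  rewrite -!sum1_card (reindex _ (onW_bij _ bij_h)) /=; apply: eq_bigl => i.
  by rewrite !inE; move: (alt i) => /=; case: (f _); case: (f _).
by move: oddZ; rewrite -cardE addnn odd_double.
Qed.

(** * Imbalances of an orientation and flow across cuts *)

Section Imbalance.
Variables (G : mgraph) (D : orientation G).

Definition out_cut (X : {set vertex G}) : {set edge G} :=
  [set e | (arc_tail D e \in X) && (arc_head D e \notin X)].
Definition in_cut (X : {set vertex G}) : {set edge G} :=
  [set e | (arc_head D e \in X) && (arc_tail D e \notin X)].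
Definition imbalance (v : vertex G) : int :=
  #|[set e | arc_tail D e == v]|%:Z - #|[set e | arc_head D e == v]|%:Z.

Lemma arc_tail_neq_head e : arc_tail D e != arc_head D e.
Proof.
apply/eqP=> th; have := card_ends e.
by rewrite (ends_orientation D e) th setUid cards1.
Qed.

(** Arcs with both ends in [X] cancel. Values in any abelian group cover both the flow itself and
    the constant 1, which counts arcs. *)
Lemma sum_tail_sub_sum_head (V : zmodType) (f : edge G -> V) (X : {set vertex G}) :
  \sum_(v in X) (\sum_(e | arc_tail D e == v) f e
                 - \sum_(e | arc_head D e == v) f e)
  = \sum_(e in out_cut X) f e - \sum_(e in in_cut X) f e.
Proof.
rewrite sumrB.
have gather (g : edge G -> vertex G) :
    \sum_(v in X) \sum_(e | g e == v) f e = \sum_(e | g e \in X) f e.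
  rewrite (partition_big g (mem X)) //=; apply: eq_bigr => v vX.
  by apply: eq_bigl => e; case: eqP => [->|]; rewrite ?vX ?andbT ?andbF.
rewrite !gather (bigID (fun e => arc_head D e \in X)) /=.
rewrite [X in _ - X](bigID (fun e => arc_tail D e \in X)) /=.
rewrite addrC [X in _ - X]addrC opprD addrACA -[RHS]addr0; congr (_ + _).
  by congr (_ - _); apply: eq_bigl => e; rewrite inE.
by apply/eqP; rewrite subr_eq0; apply/eqP/eq_bigl => e; rewrite andbC.
Qed.

Lemma sum_imbalance (X : {set vertex G}) :
  \sum_(v in X) imbalance v = #|out_cut X|%:Z - #|in_cut X|%:Z.
Proof.
have cardZ (A : {set edge G}) : #|A|%:Z = \sum_(e in A) 1.
  by rewrite sumr_const natz.
rewrite !cardZ -sum_tail_sub_sum_head; apply: eq_bigr => v _.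
by rewrite /imbalance !cardZ; congr (_ - _); apply: eq_bigl => e; rewrite inE.
Qed.

Lemma imbalance_parity (v : vertex G) :
  exists m : int, imbalance v = (degree v)%:Z - m *+ 2.
Proof.
exists #|[set e | arc_head D e == v]|%:Z.
suff -> : degree v = (#|[set e | arc_tail D e == v]| +
                      #|[set e | arc_head D e == v]|)%N.
  by rewrite /imbalance PoszD mulr2n opprD addrACA subrr addr0.
rewrite /degree -cardsUI [_ :&: _](_ : _ = set0) ?cards0 ?addn0.
  apply: eq_card => e; rewrite !inE (ends_orientation D e) !inE.
  by rewrite ![v == _]eq_sym.
apply/setP=> e; rewrite !inE; apply/negP=> /andP[/eqP tv /eqP hv].
by have := arc_tail_neq_head e; rewrite tv hv eqxx.
Qed.

(** Conservation equates the flow out of [X] with the flow into [X], while each arc carries between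
    1 and [r - 1]. The slack [(#|edge G|.+1)%:R^-1] is absorbed by integrality here and later makes
    the bound on the flow number strict. *)
Lemma imbalance_bound (R : realType) (r : R) (f : edge G -> R) (p : nat) :
    (0 < p)%N -> nowhere_zero_flow r D f ->
    r < 2 + (1 + (#|edge G|.+1)%:R^-1) / p%:R ->
  forall X : {set vertex G}, `|\sum_(v in X) imbalance v| *+ (2 * p + 1)
            <= (#|out_cut X| + #|in_cut X|)%:Z.
Proof.
move=> p_gt0 [f_bnd f_cons] r_lt X.
have cutE : \sum_(e in out_cut X) f e = \sum_(e in in_cut X) f e.
  apply/eqP; rewrite -subr_eq0 -sum_tail_sub_sum_head big1 // => v _.
  by rewrite f_cons subrr.
have lo (A : {set edge G}) : #|A|%:R <= \sum_(e in A) f e.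
  rewrite -sum1_card natr_sum; apply: ler_sum => e _.
  by case/andP: (f_bnd e).
have hi (A : {set edge G}) : \sum_(e in A) f e <= #|A|%:R * (r - 1).
  rewrite mulr_natl -sumr_const; apply: ler_sum => e _.
  by case/andP: (f_bnd e).
(* By [r_lt], [p * #|A|] is less than [(p + 1) * #|B| + 1], since the slack times [#|B|] is below 1;
   both sides are integers. *)
have key (A B : {set edge G}) : #|A|%:R <= #|B|%:R * (r - 1) ->
    (p * #|A| <= (p + 1) * #|B|)%N.
  move=> leAB; rewrite leqNgt; apply/negP=> ltBA.
  have E_ge : (#|B|%:R <= #|edge G|%:R :> R) by rewrite ler_nat max_card.
  have P : 0 < p%:R :> R by rewrite ltr0n.
  have le3 : #|B|%:R * (#|edge G|.+1)%:R^-1 < 1 :> R.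
    by rewrite ltr_pdivrMr ?ltr0Sn // mul1r (le_lt_trans E_ge) // ltr_nat.
  move: r_lt le3; rewrite -ltrBlDl ltr_pdivlMr //.
  move: (_%:R^-1) => eps r_lt le3.
  have lt1 : p%:R * (r - 1) < p%:R + 1 + eps by move: r_lt; nra.
  have le2 : (p%:R + 1) * #|B|%:R + 1 <= p%:R * #|A|%:R :> R.
    by rewrite -(natrD _ p 1) -!natrM -(natrD _ _ 1) ler_nat addn1.
  have B0 : 0 <= #|B|%:R :> R by rewrite ler0n.
  have le4 : p%:R * #|A|%:R <= #|B|%:R * (p%:R * (r - 1)).
    by rewrite mulrCA ler_pM2l.
  have := le_trans le2 le4; apply/negP; rewrite -ltNge.
  apply: le_lt_trans (ler_wpM2l B0 (ltW lt1)) _.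
  by nra.
have out_le : (p * #|out_cut X| <= (p + 1) * #|in_cut X|)%N.
  by apply: key; apply: le_trans (lo _) _; rewrite cutE.
have in_le : (p * #|in_cut X| <= (p + 1) * #|out_cut X|)%N.
  by apply: key; apply: le_trans (lo _) _; rewrite -cutE.
by rewrite sum_imbalance; lia.
Qed.

End Imbalance.

(** * Regular class 1 graphs from fixed-point-free involutions *)

Section MatchingGraph.
Variables (V C : finType) (s : C -> V -> V).
Hypotheses (sK : forall c, involutive (s c)) (s_neq : forall c v, s c v != v).

(* Every pair [{v, s c v}] is represented by its end of smaller rank. *)
Definition matching_edge :=
  {x : C * V | (enum_rank x.2 < enum_rank (s x.1 x.2))%N}.
Definition matching_color (e : matching_edge) : C := (val e).1.
Definition matching_ends (e : matching_edge) : {set V} :=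
  [set (val e).2; s (val e).1 (val e).2].

Lemma card_matching_ends e : #|matching_ends e| = 2.
Proof. by rewrite cards2 eq_sym s_neq. Qed.

Definition matching_graph : mgraph := MGraph card_matching_ends.

Lemma matching_endsP (e : matching_edge) v :
  v \in matching_ends e -> matching_ends e = [set v; s (matching_color e) v].
Proof.
rewrite /matching_ends /matching_color => /set2P[-> //|->].
by rewrite sK setUC.
Qed.

Lemma matching_edge_inj (e e' : matching_edge) v :
  v \in matching_ends e -> v \in matching_ends e' ->
  matching_color e = matching_color e' -> e = e'.
Proof.
rewrite /matching_ends /matching_color.
case: e e' => [[c u] /= lt_u] [[c' u'] /= lt_u'] ve ve' ecc'; subst c'.
apply: val_inj => /=; congr (_, _).
move: ve ve' => /set2P[->|->] /set2P[//|].
- by move=> ue; move: lt_u lt_u'; rewrite ue sK => /ltn_trans/[apply]; rewrite ltnn.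
- by move=> ue; move: lt_u lt_u'; rewrite -ue sK => /ltn_trans/[apply]; rewrite ltnn.
- by move=> /(can_inj (sK c)).
Qed.

Lemma matching_edge_at c v :
  exists2 e : matching_edge, matching_color e = c & v \in matching_ends e.
Proof.
have [lt_v|] := boolP (enum_rank v < enum_rank (s c v))%N.
  by exists (exist _ (c, v) lt_v); rewrite // /matching_ends /= set21.
rewrite -leqNgt leq_eqVlt => /orP[/eqP/val_inj/enum_rank_inj/eqP|lt_v].
  by rewrite (negPf (s_neq c v)).
have lt_v' : (enum_rank (s c v) < enum_rank (s c (s c v)))%N by rewrite sK.
by exists (exist _ (c, s c v) lt_v'); rewrite // /matching_ends /= sK set22.
Qed.

Lemma degree_matching_graph (v : vertex matching_graph) : degree v = #|C|.
Proof.
rewrite /degree -(card_in_imset (f := matching_color)).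
  apply: eq_card => c; rewrite [RHS]inE.
  have [e <- ve] := matching_edge_at c v.
  by apply: imset_f; rewrite inE.
move=> e e'; rewrite in_set => ve; rewrite in_set => ve'.
exact: (matching_edge_inj ve ve').
Qed.

(** [matching_color] is a proper colouring with [#|C|] colours, and the [#|C|] edges at a vertex
    [v0] are pairwise adjacent. *)
Lemma class1_matching_graph : (0 < #|V|)%N -> class1 matching_graph.
Proof.
case/card_gt0P=> v0 _.
have max_deg : max_degree matching_graph = #|C|.
  rewrite /max_degree (eq_bigr (fun=> #|C|)) => [|v _].
    rewrite big_const; case En: #|_| => [|n].
      by have := card0_eq En v0; rewrite inE.
    by elim: n {En} => [|n IHn]; rewrite iterS ?IHn ?maxnn // maxn0.
  exact: degree_matching_graph.
rewrite /class1 max_deg /chromatic_index; case: ex_minnP => m.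
case/existsP=> c /forallP c_proper le_m; apply/eqP; rewrite eqn_leq.
apply/andP; split.
  apply: le_m; apply/existsP.
  exists [ffun e : edge matching_graph => enum_rank (matching_color e)].
  apply/forallP=> e; apply/forallP=> e'; apply/implyP=> /andP[nee'].
  apply: contraNneq; rewrite !ffunE => /enum_rank_inj ecc'.
  rewrite -setI_eq0; apply/eqP/setP=> v; rewrite in_set0 in_setI.
  apply/negP=> /andP[ve ve'].
  by rewrite (matching_edge_inj ve ve' ecc') eqxx in nee'.
rewrite -(degree_matching_graph v0) /degree -[m in (_ <= m)%N]card_ord.
rewrite -(card_in_imset (f := c)) ?max_card // => e e'.
rewrite in_set => ve; rewrite in_set => ve' ce.
apply/eqP/negPn/negP => nee'.
have adj : adjacent_edges e e'.
  by rewrite /adjacent_edges nee' /=; apply/pred0Pn; exists v0; rewrite /= ve ve'.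
by have /forallP/(_ e') := c_proper e; rewrite adj ce eqxx.
Qed.

Lemma cut_matching_graph (D : orientation matching_graph) (X : {set V}) :
  (#|out_cut D X| + #|in_cut D X|
     <= \sum_(v in X) #|[set c | s c v \notin X]|)%N.
Proof.
(* A crossing edge is charged to its end in [X] together with its colour. *)
pose F (e : matching_edge) :=
  (if arc_tail D e \in X then arc_tail D e else arc_head D e, matching_color e).
have F_ends e : (F e).1 \in matching_ends e.
  have -> : matching_ends e = [set arc_tail D e; arc_head D e].
    exact: (ends_orientation D e).
  by rewrite /F /=; case: ifP; rewrite ?set21 ?set22.
have F_inj : injective F.
  move=> e e' eF; apply: (@matching_edge_inj _ _ (F e).1) => //.
    by rewrite eF.
  by case: eF.
have -> : (\sum_(v in X) #|[set c | s c v \notin X]| =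
    #|[set x : V * C | (x.1 \in X) && (s x.2 x.1 \notin X)]|)%N.
  rewrite -sum1_card (eq_bigr (fun v => \sum_(c | s c v \notin X) 1)%N).
    by rewrite pair_big_dep /=; apply: eq_bigl => x; rewrite inE.
  by move=> v _; rewrite -sum1_card; apply: eq_bigl => c; rewrite inE.
rewrite -cardsUI [_ :&: _](_ : _ = set0) ?cards0 ?addn0; last first.
  by apply/setP=> e; rewrite !inE; case: (_ \in X); rewrite ?andbF.
rewrite -(card_imset _ F_inj); apply: subset_leq_card; apply/fintype.subsetP=> x.
case/imsetP=> e cross_e ->{x}; rewrite !inE.
have := matching_endsP (F_ends e).
have -> : matching_ends e = [set arc_tail D e; arc_head D e].
  exact: (ends_orientation D e).
move: cross_e; rewrite !inE /F /=.
have ht := arc_tail_neq_head D e.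
case: ifPn => [tX|tX] /=; rewrite ?tX ?andbF ?orbF /= => hX eE.
  have : arc_head D e \in [set arc_tail D e; s (matching_color e) (arc_tail D e)].
    by rewrite -eE set22.
  by rewrite !inE eq_sym (negPf ht) /= => /eqP <-.
move: hX; rewrite andbT => hX; rewrite hX /=.
have : arc_tail D e \in [set arc_head D e; s (matching_color e) (arc_head D e)].
  by rewrite -eE set21.
by rewrite !inE (negPf ht) /= => /eqP <-.
Qed.

End MatchingGraph.

(* [gstep l v] is the neighbour of [v] along the local colour [l]: a vertex of
   the gadget, or one of the two terminals, [false] or [true], that the gadget
   is attached to.  The colours [Some (inl y)] are those that occur on edges to
   the terminals, [gport y t] being the neighbour of terminal [t]. *)
Record gadget (p : nat) := Gadget {
  gvertex : finType;
  gindex : finType;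
  gstep : option (gindex + gindex) -> gvertex -> gvertex + bool;
  gport : gindex -> bool -> gvertex;
  gswap : gindex -> gindex;
  card_gvertex : #|gvertex| = (4 * p)%N;
  card_gindex : #|gindex| = (2 * p)%N;
  gstepK : forall l v u, gstep l v = inl u -> gstep l u = inl v;
  gstep_neq : forall l v, gstep l v <> inl v;
  gstep_gport : forall y t, gstep (Some (inl y)) (gport y t) = inr t;
  gstep_exit : forall l v t, gstep l v = inr t ->
    exists2 y, l = Some (inl y) & v = gport y t;
  gswap_inj : injective gswap;
  gport_gswap : forall y, gport (gswap y) true = gport y false;
  gstep_complete : forall v u, v != u -> exists l, gstep l v = inl u;
  gstep_double : forall f : gvertex -> bool, exists v u l l',
    [/\ v != u, f v = f u, l != l', gstep l v = inl u & gstep l' v = inl u]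
}.

(** * Balanced cuts of a gadget *)

Section GadgetCut.
Variables (p : nat) (A : gadget p).
Implicit Types (v u : gvertex A) (W : {set gvertex A}) (t : bool).

Definition gmult v u := #|[set l | gstep l v == inl u]|.
Definition gexit v t := #|[set l | gstep l v == inr t]|.
(** The cut has [W] and terminal [~~ t] on one side, so of the edges to terminals only those to [t]
    leave. *)
Definition gout W t v :=
  #|[set l | match gstep l v with inl u => u \notin W | inr t' => t' == t end]|.

Lemma gmultC v u : gmult v u = gmult u v.
Proof.
apply: eq_card => l; rewrite !inE.
by apply/eqP/eqP => /(@gstepK _ A).
Qed.

Lemma gmult_gt0 v u : (u != v <= gmult v u)%N.
Proof.
case: eqVneq => //= nvu; apply/card_gt0P; rewrite eq_sym in nvu.
by have [l lE] := @gstep_complete _ A v u nvu; exists l; rewrite inE lE.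
Qed.

Lemma sum_gstep v : (\sum_u gmult v u + \sum_t gexit v t = 4 * p + 1)%N.
Proof.
have -> : (4 * p + 1 = #|{: option (gindex A + gindex A)}|)%N.
  by rewrite card_option card_sum card_gindex; lia.
rewrite -sum1_card (partition_big (fun l => gstep l v) xpredT) //= big_sumType.
by congr (_ + _)%N; apply: eq_bigr => r _; rewrite /gmult /gexit -sum1_card;
   apply: eq_bigl => l; rewrite inE.
Qed.

Lemma gexitE v t : gexit v t = #|[set y | gport y t == v]|.
Proof.
have inj : injective (fun y : gindex A => Some (inl y) : option (_ + gindex A)).
  by move=> y y' [].
rewrite -(card_imset _ inj); apply: eq_card => l; rewrite inE.
apply/eqP/imsetP => [/(@gstep_exit _ A)[y -> ->]|[y]].
  by exists y; rewrite ?inE.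
by rewrite inE => /eqP <- ->; rewrite gstep_gport.
Qed.

Lemma sum_gexit W t : (\sum_(v in W) gexit v t = #|[set y | gport y t \in W]|)%N.
Proof.
rewrite -sum1_card (partition_big (fun y => gport y t) (mem W)) /=; last first.
  by move=> y; rewrite inE.
apply: eq_bigr => v vW; rewrite gexitE -sum1_card; apply: eq_bigl => y.
by rewrite !inE; case: eqP => [->|]; rewrite ?vW ?andbF.
Qed.

Lemma sum_gexitT t : (\sum_v gexit v t = 2 * p)%N.
Proof.
rewrite -(card_gindex A) -[in RHS]cardsT.
rewrite -(eq_bigl _ _ (fun v => in_setT v)) /= sum_gexit.
by apply: eq_card => y; rewrite !inE.
Qed.

(** By [gswap], both terminals meet the same vertices with equal multiplicities. *)
Lemma card_gport_swap W t :
  #|[set y | gport y (~~ t) \in W]| = #|[set y | gport y t \in W]|.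
Proof.
suff swapE : #|[set y | gport y true \in W]| = #|[set y | gport y false \in W]|.
  by case: t; rewrite swapE.
rewrite -!sum1_card (reindex_inj (@gswap_inj _ A)); apply: eq_bigl => y.
by rewrite !inE gport_gswap.
Qed.

(** Without the [4p] edges to terminals, the degrees sum to [16p^2]. The two sides keep more than
    [4p(2p - 1)] of this, and half of the rest is the cut. *)
Lemma gmult_cut W : #|W| = (2 * p)%N ->
  (\sum_(v in W) \sum_(u in ~: W) gmult v u < 4 * p ^ 2 + 2 * p)%N.
Proof.
move=> cardW.
have cardWC : #|~: W| = (2 * p)%N by rewrite cardsCs setCK card_gvertex cardW; lia.
pose e (P Q : {set gvertex A}) := (\sum_(v in P) \sum_(u in Q) gmult v u)%N.
have split_row v : (\sum_u gmult v u =
    \sum_(u in W) gmult v u + \sum_(u in ~: W) gmult v u)%N.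
  by rewrite (bigID (mem W)) /=; congr (_ + _)%N; apply: eq_bigl => u; rewrite ?inE.
have total : (e W W + e W (~: W) + (e (~: W) W + e (~: W) (~: W)) + 4 * p
              = 4 * p * (4 * p + 1))%N.
  have -> : (4 * p * (4 * p + 1) = \sum_(v : gvertex A) (4 * p + 1))%N.
    by rewrite sum_nat_const card_gvertex.
  under [RHS]eq_bigr => v _ do rewrite -(sum_gstep v) split_row.
  rewrite big_split /=; congr (_ + _)%N.
    rewrite (bigID (mem W)) /= /e -!big_split /=; congr (_ + _)%N.
    by apply: eq_bigl => u; rewrite !inE.
  rewrite exchange_big /= (eq_bigr (fun=> 2 * p)%N) => [|t _].
    by rewrite sum_nat_const card_bool; lia.
  exact: sum_gexitT.
have sym : e W (~: W) = e (~: W) W.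
  rewrite /e exchange_big; apply: eq_bigr => v _; apply: eq_bigr => u _.
  exact: gmultC.
have row (P : {set gvertex A}) v : v \in P -> #|P| = (2 * p)%N ->
    (\sum_(u in P) (u != v) = 2 * p - 1)%N.
  move=> vP cardP; rewrite (bigD1 v) //= eqxx add0n.
  rewrite (eq_bigr (fun=> 1%N)) => [|u /andP[_ ->]//].
  rewrite sum1_card; have := cardsD1 v P; rewrite vP cardP.
  rewrite (eq_card (B := P :\ v)); last by move=> u; rewrite !inE andbC.
  by lia.
(* All pairs of vertices are adjacent, so each side spans at least the edges of
   a complete graph; the doubled edge inside one side makes this strict. *)
have mono (P : {set gvertex A}) : #|P| = (2 * p)%N ->
    (2 * p * (2 * p - 1) <= e P P)%N.
  move=> cardP; rewrite -{1}cardP -sum_nat_const; apply: leq_sum => v vP.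
  by rewrite -(row P v vP cardP); apply: leq_sum => u _; apply: gmult_gt0.
have mono_strict (P : {set gvertex A}) v u l l' : #|P| = (2 * p)%N ->
    v \in P -> u \in P -> v != u -> l != l' ->
    gstep l v = inl u -> gstep l' v = inl u -> (2 * p * (2 * p - 1) < e P P)%N.
  move=> cardP vP uP nvu nll lE l'E; rewrite -{1}cardP -sum_nat_const /e.
  rewrite (bigD1 v) //= [X in (_ < X)%N](bigD1 v) //= -addSn; apply: leq_add.
    rewrite -(row P v vP cardP) (bigD1 u) //= [X in (_ < X)%N](bigD1 u) //= -addSn.
    apply: leq_add; last by apply: leq_sum => w _; apply: gmult_gt0.
    rewrite eq_sym nvu; apply: leq_trans (_ : #|[set l; l']| <= _)%N.
      by rewrite cards2 nll.
    by apply: subset_leq_card; apply/fintype.subsetP=> k /set2P[]->; rewrite inE ?lE ?l'E.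
  apply: leq_sum => w /andP[wP _].
  by rewrite -(row P w wP cardP); apply: leq_sum => x _; apply: gmult_gt0.
have : (2 * (2 * p * (2 * p - 1)) < e W W + e (~: W) (~: W))%N.
  have [v [u [l [l' [nvu fvu nll lE l'E]]]]] :=
    @gstep_double _ A (fun v => v \in W).
  have [vW|vW] := boolP (v \in W).
    have := mono_strict W v u l l' cardW vW; rewrite -fvu vW.
    move=> /(_ isT nvu nll lE l'E); have := mono _ cardWC; lia.
  have := mono_strict (~: W) v u l l' cardWC; rewrite !inE -fvu vW.
  move=> /(_ isT isT nvu nll lE l'E); have := mono _ cardW; lia.
by rewrite -/(e W (~: W)) -sym in total *; move: total; nia.
Qed.

(** The second term counts the edges from terminal [~~ t] to vertices outside [W]. By
    [card_gport_swap] the terminal edges in the cut always number [2p]. *)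
Lemma gout_bound W t : #|W| = (2 * p)%N ->
  (\sum_(v in W) gout W t v + #|[set y | gport y (~~ t) \notin W]|
     < 4 * p ^ 2 + 4 * p)%N.
Proof.
move=> cardW.
have goutE v : gout W t v = (\sum_(u in ~: W) gmult v u + gexit v t)%N.
  rewrite /gout -sum1_card.
  rewrite (partition_big (fun l => gstep l v)
             (fun r => match r with inl u => u \notin W | inr t' => t' == t end));
    last by move=> l; rewrite inE.
  rewrite big_sumType /= big_pred1_eq; congr (_ + _)%N.
    apply: eq_big => [u|u uW]; rewrite ?inE // /gmult -sum1_card.
    by apply: eq_bigl => l; rewrite !inE; case: eqP => [->|]; rewrite ?uW ?andbF.
  rewrite /gexit -sum1_card.
  by apply: eq_bigl => l; rewrite !inE; case: eqP => [->|]; rewrite ?eqxx ?andbF.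
under eq_bigr => v _ do rewrite goutE.
rewrite big_split /= sum_gexit -card_gport_swap.
have := gmult_cut cardW; have := cardsC [set y | gport y (~~ t) \in W].
rewrite (eq_card (A := ~: _) (B := [set y | gport y (~~ t) \notin W])); last first.
  by move=> y; rewrite !inE.
rewrite card_gindex; lia.
Qed.

End GadgetCut.

(** * The ring of gadgets and its colour involutions *)

Section RingGraph.
Variables (p : nat) (A : gadget p).
Hypothesis p_gt0 : (0 < p)%N.

Let Z : finZmodType := 'I_(4 * p).+1.
Let lcol : finType := option (gindex A + gindex A).
Let h : Z := inord (2 * p + 1).

Definition port_lcols : seq lcol := [seq Some (inl y) | y <- enum (gindex A)].
Definition inner_lcols : seq lcol := [seq Some (inr y) | y <- enum (gindex A)].
(** The order matters: [None] at 0, ports at 1 to [2p], inner colours after. For [m != 0] exactly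
    one of [m] and [m + h] is then a port position; for [m = 0] neither is. *)
Definition lcol_enum : seq lcol := None :: port_lcols ++ inner_lcols.
Definition lcol_of (m : Z) : lcol := nth None lcol_enum m.
Definition is_port (l : lcol) := if l is Some (inl _) then true else false.

Lemma size_port_lcols : size port_lcols = (2 * p)%N.
Proof. by rewrite /port_lcols size_map -cardT card_gindex. Qed.

Lemma size_inner_lcols : size inner_lcols = (2 * p)%N.
Proof. by rewrite /inner_lcols size_map -cardT card_gindex. Qed.

Lemma size_lcol_enum : size lcol_enum = (4 * p).+1.
Proof.
rewrite -[size _]/(size (port_lcols ++ inner_lcols)).+1.
by rewrite size_cat size_port_lcols size_inner_lcols; lia.
Qed.

Lemma lcol_of_inj : injective lcol_of.
Proof.
have uniq_enum : uniq lcol_enum.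
  have uniq_ports : uniq port_lcols by rewrite map_inj_uniq ?enum_uniq // => y y' [].
  have uniq_inner : uniq inner_lcols by rewrite map_inj_uniq ?enum_uniq // => y y' [].
  rewrite cons_uniq mem_cat negb_or cat_uniq uniq_ports uniq_inner andbT /= -andbA.
  apply/and3P; split; [by apply/mapP=> -[] | by apply/mapP=> -[] |].
  by apply/hasPn=> l /mapP[y _ ->]; apply/mapP=> -[].
move=> m m' /eqP; rewrite nth_uniq ?size_lcol_enum ?ltn_ord // => /eqP.
exact: val_inj.
Qed.

Lemma is_port_lcol_of (m : Z) : is_port (lcol_of m) = (0 < m <= 2 * p)%N.
Proof.
have ports : all is_port port_lcols.
  by apply/allP=> l /mapP[y _ ->].
have nonports : all (predC is_port) inner_lcols.
  by apply/allP=> l /mapP[y _ ->].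
case: m => [[|m] lt_m]; first by [].
rewrite -[lcol_of _]/(nth None (port_lcols ++ inner_lcols) m).
rewrite nth_cat size_port_lcols [nat_of_ord _]/=.
case: ltnP => lt_mp.
  by apply: (all_nthP None ports); rewrite size_port_lcols.
apply/negbTE/(all_nthP None nonports).
by rewrite size_inner_lcols; lia.
Qed.

Lemma lcol_of_port (m : Z) : is_port (lcol_of m) -> ~~ is_port (lcol_of (m + h)).
Proof.
rewrite !is_port_lcol_of /= inordK; last by lia.
case: m => m lt_m /= /andP[m_gt0 le_m].
have [lt|ge] := ltnP (m + (2 * p + 1)) (4 * p).+1; first by rewrite modn_small //; lia.
have -> : (m + (2 * p + 1) = (4 * p).+1)%N by lia.
by rewrite modnn.
Qed.

Lemma lcol_of_neq0 (m : Z) :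
  m != 0 -> is_port (lcol_of m) || is_port (lcol_of (m + h)).
Proof.
rewrite !is_port_lcol_of /= inordK; last by lia.
case: m => m lt_m; rewrite -val_eqE /= => m_neq0.
have [//|gt_m] := leqP m (2 * p); first by lia.
have -> : (m + (2 * p + 1) = (m - 2 * p) + (4 * p).+1)%N by lia.
by rewrite modnDr modn_small; lia.
Qed.

Lemma lcol_ofh : ~~ is_port (lcol_of h).
Proof. by rewrite is_port_lcol_of /= inordK; lia. Qed.

Lemma h_neq0 : h != 0.
Proof. by rewrite -val_eqE /= inordK; lia. Qed.

Lemma hh_neq0 : h + h != 0.
Proof.
rewrite -val_eqE /= inordK; last by lia.
have -> : (2 * p + 1 + (2 * p + 1) = 1 + (4 * p).+1)%N by lia.
by rewrite modnDr modn_small; lia.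
Qed.

(* Terminal [i] is attached to gadget [i] as [false] and to gadget [i - h] as
   [true]; since [h] is half of [1] modulo [4p+1], its [4p+1] colours then
   split into the ports of both gadgets and the colour [i] of the edge to the
   hub. *)
Definition ring_vertex : finType := ((unit + Z) + Z * gvertex A)%type.
Definition hub : ring_vertex := inl (inl tt).
Definition terminal (i : Z) : ring_vertex := inl (inr i).
Definition inner (i : Z) (v : gvertex A) : ring_vertex := inr (i, v).

(** Colour [c] acts in gadget [i] as local colour number [c - i], hence in gadget [i - h] as number
    [c - i + h]. The default branch [hub] arises only for [c = i]. *)
Definition ring_step (c : Z) (x : ring_vertex) : ring_vertex :=
  match x with
  | inl (inl _) => terminal c
  | inl (inr i) =>
      match lcol_of (c - i), lcol_of (c - i + h) with
      | Some (inl y), _ => inner i (gport y false)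
      | _, Some (inl y) => inner (i - h) (gport y true)
      | _, _ => hub
      end
  | inr (i, v) =>
      match gstep (lcol_of (c - i)) v with
      | inl u => inner i u
      | inr t => terminal (if t then i + h else i)
      end
  end.

Variant ring_step_terminal_spec (c i : Z) : ring_vertex -> Prop :=
  | StepRight y of lcol_of (c - i) = Some (inl y) :
      ring_step_terminal_spec c i (inner i (gport y false))
  | StepLeft y of lcol_of (c - i + h) = Some (inl y) :
      ring_step_terminal_spec c i (inner (i - h) (gport y true))
  | StepHub of c = i : ring_step_terminal_spec c i hub.

Lemma ring_stepP c i : ring_step_terminal_spec c i (ring_step c (terminal i)).
Proof.
rewrite /ring_step /=; have := @lcol_of_neq0 (c - i).
case E: (lcol_of (c - i)) => [[y|y]|] /= c_neq; first exact: StepRight.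
  case E': (lcol_of (c - i + h)) c_neq => [[y'|y']|] c_neq; first exact: StepLeft.
    by apply: StepHub; apply/eqP; rewrite -subr_eq0; apply: contraT => /c_neq.
  by apply: StepHub; apply/eqP; rewrite -subr_eq0; apply: contraT => /c_neq.
case E': (lcol_of (c - i + h)) c_neq => [[y'|y']|] c_neq; first exact: StepLeft.
  by apply: StepHub; apply/eqP; rewrite -subr_eq0; apply: contraT => /c_neq.
by apply: StepHub; apply/eqP; rewrite -subr_eq0; apply: contraT => /c_neq.
Qed.

Lemma ring_stepK c : involutive (ring_step c).
Proof.
case=> [[[]|i]|[i v]].
- rewrite /= subrr add0r; have := lcol_ofh.
  by case: (lcol_of h) => [[]|].
- rewrite -/(terminal i); case: ring_stepP => [y E|y E|->] //=.
    by rewrite E gstep_gport.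
  by rewrite opprB addrCA [h + _]addrC E gstep_gport /= subrK.
- rewrite /=; case E: gstep => [u|[]] /=.
  + by rewrite (gstepK E).
  (* Terminal [i + h] tries gadget [i + h] first; by [lcol_of_port] the colour is no port there, so
     the step leads back to gadget [i]. *)
  + have [y yE ->] := gstep_exit E.
    have -> : c - (i + h) = c - i - h by rewrite opprD addrA.
    rewrite subrK yE; have := @lcol_of_port (c - i - h); rewrite subrK yE /=.
    case: (lcol_of (c - i - h)) => [[y'|y']|] /=.
      by move/(_ isT).
    by rewrite addrK.
    by rewrite addrK.
  + by have [y -> ->] := gstep_exit E.
Qed.

Lemma ring_step_neq c x : ring_step c x != x.
Proof.
case: x => [[[]|i]|[i v]] //.
  by rewrite -/(terminal i); case: ring_stepP.
rewrite /=; case E: gstep => [u|[]] //=; apply/eqP=> -[uv].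
by rewrite uv in E; case: (gstep_neq E).
Qed.

Definition ring_graph : mgraph := matching_graph ring_step_neq.

Definition step_out (X : {set ring_vertex}) (x : ring_vertex) : nat :=
  #|[set c | ring_step c x \notin X]|.

Lemma leq_card_lcol i (S : {set Z}) (T : {set lcol}) :
  (forall c, c \in S -> lcol_of (c - i) \in T) -> (#|S| <= #|T|)%N.
Proof.
move=> ST; have inj : injective (fun c => lcol_of (c - i)).
  by move=> c c' /lcol_of_inj/addIr.
rewrite -(card_imset _ inj); apply/subset_leq_card/fintype.subsetP=> l.
by case/imsetP=> c /ST ? ->.
Qed.

(** * No sign function meets the bound on every cut *)

Section Balance.
Variable beta : ring_vertex -> bool.
Let sgn (x : ring_vertex) : int := if beta x then 1 else -1.
Hypothesis balanced : forall X : {set ring_vertex},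
  `|\sum_(x in X) sgn x| *+ (2 * p + 1) <= (\sum_(x in X) step_out X x)%:Z.

Definition sgn_class i e : {set gvertex A} := [set v | beta (inner i v) == e].

Lemma sum_sgn_inner i :
  \sum_v sgn (inner i v) = #|sgn_class i true|%:Z - #|sgn_class i false|%:Z.
Proof.
rewrite (bigID (fun v => beta (inner i v))) /=; congr (_ + _).
  rewrite (eq_bigr (fun=> 1)) => [|v vW]; last by rewrite /sgn vW.
  by rewrite sumr_const natz; congr _%:Z; apply: eq_card => v; rewrite !inE eqb_id.
rewrite (eq_bigr (fun=> -1)) => [|v /negPf vW]; last by rewrite /sgn vW.
rewrite sumr_const mulNrn natz; congr (- _%:Z).
by apply: eq_card => v; rewrite !inE eqbF_neg.
Qed.

(** At most [4p] edges leave a whole gadget. Unequal classes of total size [4p] would differ by at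
    least 2, but [2(2p + 1)] exceeds [4p]. *)
Lemma card_sgn_class i e : #|sgn_class i e| = (2 * p)%N.
Proof.
pose X : {set ring_vertex} := [set inner i v | v in [set: gvertex A]].
have inner_inj : injective (inner i) by move=> v u [].
have sumX (R : Type) (idx : R) (op : Monoid.com_law idx) (F : ring_vertex -> R) :
    \big[op/idx]_(x in X) F x = \big[op/idx]_v F (inner i v).
  rewrite big_imset /=; last by move=> v u _ _; exact: inner_inj.
  by apply: eq_bigl => v; rewrite inE.
have innerX v : inner i v \in X by apply: imset_f; rewrite inE.
have outX v : (step_out X (inner i v) <= gexit v false + gexit v true)%N.
  apply: leq_trans (leq_card_setU _ _); apply: (@leq_card_lcol i) => c.
  rewrite !inE /=; case: gstep => [u|[]] //.
  by rewrite innerX.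
have sum_out : (\sum_(x in X) step_out X x <= 4 * p)%N.
  rewrite sumX; apply: (@leq_trans (\sum_v (gexit v false + gexit v true))%N).
    by apply: leq_sum => v _; exact: outX.
  rewrite big_split /=.
  by rewrite !sum_gexitT; lia.
have card_split : (#|sgn_class i true| + #|sgn_class i false| = 4 * p)%N.
  rewrite -(card_gvertex A) -(cardsC (sgn_class i true)); congr (_ + _)%N.
  by apply: eq_card => v; rewrite !inE; case: (beta _).
have eq_card_class : #|sgn_class i true| = #|sgn_class i false|.
  apply/eqP/negPn/negP=> neq.
  have ge2 : 2 <= `|#|sgn_class i true|%:Z - #|sgn_class i false|%:Z| by lia.
  have := balanced X; rewrite sumX sum_sgn_inner.
  by move: (ler_wMn2r (2 * p + 1) ge2); lia.
by case: e; lia.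
Qed.

Lemma ring_unbalanced : False.
Proof.
have oddZ : odd #|Z| by rewrite card_ord /= oddM.
have [i same] := odd_cycle_not_2colorable h (fun i => beta (terminal i)) oddZ.
pose e := beta (terminal i).
pose W j := sgn_class j e.
pose P1 (j : Z) := (j == i) || (j == i + h).
pose P2 (jv : Z * gvertex A) :=
  (jv.1 == i) || ((jv.1 == i - h) || (jv.1 == i + h)) && (jv.2 \in W jv.1).
(* Terminals [i] and [i + h] bound gadget [i]; the gadgets [i - h] and [i + h] on either side
   contribute only their vertices of sign [e]. *)
pose X : {set ring_vertex} := [set x | match x with
  inl (inl _) => false | inl (inr j) => P1 j | inr jv => P2 jv end].
have ih_i : i + h != i by rewrite -subr_eq0 addrAC subrr add0r h_neq0.
have i_ih : i - h != i by rewrite -subr_eq0 addrAC subrr add0r oppr_eq0 h_neq0.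
have ih_ih : i + h != i - h.
  by rewrite -(inj_eq (addIr h)) subrK -addrA -subr_eq0 addrAC subrr add0r hh_neq0.
(* An arbitrary commutative monoid serves both the integer sum of signs and the natural sum of
   [step_out]. *)
have sumX (R : Type) (idx : R) (op : Monoid.com_law idx) (F : ring_vertex -> R) :
    \big[op/idx]_(x in X) F x =
    op (op (F (terminal i)) (F (terminal (i + h))))
       (op (\big[op/idx]_v F (inner i v))
           (op (\big[op/idx]_(v in W (i - h)) F (inner (i - h) v))
               (\big[op/idx]_(v in W (i + h)) F (inner (i + h) v)))).
  rewrite big_mkcond !big_sumType /= big1 ?Monoid.mul1m; last first.
    by move=> x _; rewrite inE.
  congr (op _ _).
    rewrite (bigD1 i) //= (bigD1 (i + h)) //= big1 ?Monoid.mulm1; last first.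
      by move=> j /andP[/negPf ji /negPf jh]; rewrite inE /P1 ji jh.
    by rewrite !inE /P1 !eqxx orbT.
  rewrite (eq_bigr (fun jv => (fun j v =>
     if inner j v \in X then F (inner j v) else idx) jv.1 jv.2)); last by case.
  rewrite -(pair_bigA _ (fun j v => if inner j v \in X then F (inner j v) else idx)) /=.
  rewrite (bigD1 i) //= (bigD1 (i - h)) //= (bigD1 (i + h)) /=; last by rewrite ih_i.
  rewrite [X in op _ (op _ (op _ X))]big1 ?Monoid.mulm1; last first.
    move=> j /andP[/andP[/negPf ji /negPf jm] /negPf jp].
    by apply: big1 => v _; rewrite inE /P2 /= ji jm jp.
  congr (op _ (op _ _)).
  - by apply: eq_bigr => v _; rewrite inE /P2 /= eqxx.
  - rewrite [RHS]big_mkcond; apply: eq_bigr => v _.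
    by rewrite inE /P2 /= (negPf i_ih) eqxx.
  - rewrite [RHS]big_mkcond; apply: eq_bigr => v _.
    by rewrite inE /P2 /= (negPf ih_i) eqxx orbT.
have cardW j : #|W j| = (2 * p)%N by apply: card_sgn_class.
have sgn_e j v : v \in W j -> sgn (inner j v) = sgn (terminal i).
  by rewrite inE /sgn -/e => /eqP ->.
have sum_sgn_class j : \sum_(v in W j) sgn (inner j v) = sgn (terminal i) *+ (2 * p).
  by rewrite (eq_bigr _ (fun v => @sgn_e j v)) sumr_const cardW.
have sum_sgn : `|\sum_(x in X) sgn x| = (4 * p + 2)%:Z.
  rewrite sumX /= sum_sgn_inner !card_sgn_class subrr add0r !sum_sgn_class.
  by rewrite /sgn same; case: (beta (terminal i)); lia.
have inX (j : Z) v : (inner j v \in X) = P2 (j, v) by rewrite inE.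
have inT (j : Z) : (terminal j \in X) = P1 j by rewrite inE.
pose port_lcol (y : gindex A) : lcol := Some (inl y).
have out_left : (step_out X (terminal i)
    <= 1 + #|[set y | gport y true \notin W (i - h)%R]|)%N.
  (* The extra colour is the hub edge: colour [i] is number [h] in gadget [i - h]. In [out_right] it
     is number 0, that is [None]. *)
  apply: leq_trans (_ : #|lcol_of h |: port_lcol @:
    [set y | gport y true \notin W (i - h)%R]| <= _)%N; last first.
    by rewrite cardsU1; apply: leq_add; [case: (_ \notin _) | apply: leq_imset_card].
  apply: (@leq_card_lcol (i - h)) => c; rewrite inE.
  have -> : c - (i - h) = c - i + h by rewrite opprB addrCA addrC.
  case: ring_stepP => [y E|y E|->].
  - by rewrite inX /P2 eqxx.
  - rewrite inX /P2 /= (negPf i_ih) eqxx /= E => yW.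
    by rewrite in_setU1 imset_f ?orbT // inE.
  - by rewrite subrr add0r setU11.
have out_right : (step_out X (terminal (i + h)%R)
    <= 1 + #|[set y | gport y false \notin W (i + h)%R]|)%N.
  apply: leq_trans (_ : #|None |: port_lcol @:
    [set y | gport y false \notin W (i + h)%R]| <= _)%N; last first.
    by rewrite cardsU1; apply: leq_add; [case: (_ \notin _) | apply: leq_imset_card].
  apply: (@leq_card_lcol (i + h)) => c; rewrite inE.
  case: ring_stepP => [y E|y E|->].
  - rewrite inX /P2 /= (negPf ih_i) eqxx orbT /= E => yW.
    by rewrite in_setU1 imset_f ?orbT // inE.
  - by rewrite addrK inX /P2 eqxx.
  - by rewrite subrr setU11.
have out_inner v : step_out X (inner i v) = 0%N.
  apply/eqP; rewrite cards_eq0 -subset0; apply/fintype.subsetP=> c; rewrite inE /=.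
  by case: gstep => [u|[]] /=; rewrite ?inX ?inT /P2 /P1 /= eqxx ?orbT.
have out_prev v : (step_out X (inner (i - h)%R v) <= gout (W (i - h)%R) false v)%N.
  apply: (@leq_card_lcol (i - h)) => c; rewrite inE [lcol_of _ \in _]inE /=.
  case: gstep => [u|[]] //=; last by rewrite subrK inT /P1 eqxx.
  by rewrite inX /P2 /= (negPf i_ih) eqxx.
have out_next v : (step_out X (inner (i + h)%R v) <= gout (W (i + h)%R) true v)%N.
  apply: (@leq_card_lcol (i + h)) => c; rewrite inE [lcol_of _ \in _]inE /=.
  case: gstep => [u|[]] //=; last by rewrite inT /P1 eqxx orbT.
  by rewrite inX /P2 /= (negPf ih_i) eqxx orbT.
have sum_prev : (\sum_(v in W (i - h)%R) step_out X (inner (i - h)%R v)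
    <= \sum_(v in W (i - h)%R) gout (W (i - h)%R) false v)%N.
  by apply: leq_sum => v _; exact: out_prev.
have sum_next : (\sum_(v in W (i + h)%R) step_out X (inner (i + h)%R v)
    <= \sum_(v in W (i + h)%R) gout (W (i + h)%R) true v)%N.
  by apply: leq_sum => v _; exact: out_next.
have sum_inner : (\sum_v step_out X (inner i v) = 0)%N.
  by apply: big1 => v _; exact: out_inner.
(* The left side is [(4p + 2)(2p + 1) = 8p^2 + 8p + 2]; the right side is at most
   [2 + 2(4p^2 + 4p - 1) = 8p^2 + 8p]. *)
have := balanced X; rewrite sum_sgn sumX /= sum_inner.
have := gout_bound false (cardW (i - h)); have := gout_bound true (cardW (i + h)).
move: out_left out_right sum_prev sum_next => /=; nia.
Qed.

End Balance.
End RingGraph.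

(** * A gadget over a finite ring in which 2 is invertible *)

Section ConcreteGadget.
Variable Q : finComUnitRingType.
Hypothesis unit2 : (2%:R : Q) \is a GRing.unit.

Definition half (a : Q) : Q := a / 2%:R.

Lemma half2 a : half a + half a = a.
Proof. by rewrite -mulr2n -[LHS]mulr_natr /half divrK. Qed.

Lemma half_add a : half (a + a) = a.
Proof. by rewrite /half -mulr2n -[a *+ 2]mulr_natr mulrK. Qed.

Lemma add_self_inj : injective (fun a : Q => a + a).
Proof. by move=> a b /(congr1 half); rewrite !half_add. Qed.

(* Vertices [(false, (e, a))] carry the edges to the terminals, vertices
   [(true, (e, a))] carry the doubled edges. *)
Let A : finType := (bool * (bool * Q))%type.
Let Y : finType := (bool * Q)%type.

(* On [(true, (e, a))], a cyclic shift by [1] of the copy [e = true] of [Q]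
   turns the difference-one edges into rungs; [rung_or s] follows the
   transposition [s] in both copies where it moves a vertex, and the rung
   elsewhere. *)
Definition rung_or (s : {perm Q}) (e : bool) (a : Q) : bool * Q :=
  let a' := if e then a - 1 else a in
  if s a' == a' then (~~ e, if e then a - 1 else a + 1)
  else (e, if e then s a' + 1 else s a').

(** A transposition moves a point exactly when it moves its image, so the two branches of [rung_or]
    do not mix. *)
Lemma rung_orK (x y : Q) (e e' : bool) (a a' : Q) :
  rung_or (tperm x y) e a = (e', a') -> rung_or (tperm x y) e' a' = (e, a).
Proof.
by rewrite /rung_or; case: e; case: eqP => sa [<- <-] /=;
   rewrite ?addrK ?subrK ?tpermK ?sa ?eqxx ?addrK ?subrK //; case: eqP => // s_a';
   case: sa; rewrite -{1}s_a'.
Qed.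

Lemma rung_or_neq s e a : rung_or s e a != (e, a).
Proof.
rewrite /rung_or; case: ifPn => [_|neq]; first by rewrite xpair_eqE; case: e.
rewrite xpair_eqE eqxx /=; case: e neq => //.
by rewrite -(inj_eq (addIr 1) (s _)) subrK.
Qed.

(* The colours [Some (inl (false, k))] reflect [Q] in [k] and the colours
   [Some (inl (true, k))] translate by [k] from copy [false] to copy [true].
   On the first half, the fixed point [k] of the reflection and the pair
   [k, k + k] of the translation are sent to the terminals instead; the colour
   [Some (inl (true, 0))] takes over these pairs [a, a + a].  On the second
   half, that colour, [None], and the translation by [1] are replaced by three
   matchings [rung_or s] whose transpositions [s] form a triangle in each copy. *)
Definition ports_step (l : option (Y + Y)) (e : bool) (a : Q) : A + bool :=
  match l with
  | None => inl (false, (~~ e, a))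
  | Some (inl (false, k)) =>
      if a == k then inr e else inl (false, (e, k + k - a))
  | Some (inl (true, k)) =>
      if e then
        if a == k + k then inr false
        else inl (false, (false, if k == 0 then half a else a - k))
      else
        if a == k then inr true
        else inl (false, (true, if k == 0 then a + a else a + k))
  | Some (inr (d, k)) => inl (true, (e (+) d, a + k))
  end.

(** Rungs of difference 0 join the fixed points of the reflections, translations give the
    differences other than 0 and 1, and [rung_or] gives difference 1. *)
Definition doubled_step (l : option (Y + Y)) (e : bool) (a : Q) : A + bool :=
  match l with
  | None => inl (true, rung_or (tperm 0 1) e a)
  | Some (inl (false, k)) =>
      inl (if a == k then (true, (~~ e, a)) else (true, (e, k + k - a)))
  | Some (inl (true, k)) => inl (true,
      if k == 0 then rung_or (tperm 1 (-1)) e a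
      else if k == 1 then rung_or (tperm 0 (-1)) e a
      else (~~ e, if e then a - k else a + k))
  | Some (inr (d, k)) => inl (false, (e (+) d, a - k))
  end.

Definition local_step (l : option (Y + Y)) (v : A) : A + bool :=
  let: (doubled, (e, a)) := v in
  if doubled then doubled_step l e a else ports_step l e a.

Definition local_port (y : Y) (t : bool) : A :=
  let: (shift, k) := y in
  if shift then if t then (false, (false, k)) else (false, (true, k + k))
  else (false, (t, k)).

(** Each vertex of the half [(false, _)] has one edge to each terminal; the swap passes from the
    index of its edge to [false] to that of its edge to [true]. *)
Definition local_swap (y : Y) : Y :=
  let: (shift, k) := y in (~~ shift, if shift then k + k else k).

Lemma local_stepK l v u : local_step l v = inl u -> local_step l u = inl v.
Proof.
case: v => [[] [e a]] /=.
  case: l => [[[[] k]|[d k]]|] /=.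
  - have [->|k_neq0] := eqVneq k 0; last have [->|k_neq1] := eqVneq k 1.
    + case E: rung_or => [e' a'] [<-] /=; rewrite eqxx.
      by rewrite (rung_orK E).
    + case E: rung_or => [e' a'] [<-] /=; rewrite oner_eq0 eqxx.
      by rewrite (rung_orK E).
    + case=> <- /=; rewrite (negPf k_neq0) (negPf k_neq1) negbK.
      by case: e; rewrite /= ?addrK ?subrK.
  - case: eqVneq => [->|neq] [<-] /=; first by rewrite eqxx negbK.
    rewrite (negPf (_ : k + k - a != k)).
      by rewrite opprB addrC subrK.
    by rewrite subr_eq (inj_eq (addrI k)) eq_sym.
  - by case=> <- /=; rewrite subrK -addbA addbb addbF.
  - case E: rung_or => [e' a'] [<-] /=.
    by rewrite (rung_orK E).
case: l => [[[[] k]|[d k]]|] /=.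
- case: e; case: eqVneq => // neq [<-] /=; case: (eqVneq k 0) neq => [->|k_neq0] neq.
  + rewrite addr0 in neq.
    rewrite half2 (negPf (_ : half a != 0)) //.
    by apply: contra neq => /eqP h0; rewrite -(half2 a) h0 addr0.
  + by rewrite subr_eq (negPf neq) subrK.
  + by rewrite half_add (inj_eq add_self_inj) (negPf neq).
  + by rewrite (inj_eq (addIr k)) (negPf neq) addrK.
- case: eqVneq => // neq [<-] /=.
  rewrite (negPf (_ : k + k - a != k)).
    by rewrite opprB addrC subrK.
  by rewrite subr_eq (inj_eq (addrI k)) eq_sym.
- by case=> <- /=; rewrite addrK -addbA addbb addbF.
- by case=> <- /=; rewrite negbK.
Qed.

Lemma local_step_neq l v : local_step l v <> inl v.
Proof.
have reflect_neq (a k : Q) : a != k -> k + k - a <> a.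
  move=> neq /eqP; rewrite subr_eq (inj_eq add_self_inj) eq_sym.
  by rewrite (negPf neq).
case: v => [[] [e a]] /=.
  case: l => [[[[] k]|[d k]]|] //=.
  - case: ifP => _; last case: ifP => _.
    + by case E: rung_or => [e' a'] [ee aa]; have := rung_or_neq (tperm 1 (-1)) e a;
         rewrite E ee aa eqxx.
    + by case E: rung_or => [e' a'] [ee aa]; have := rung_or_neq (tperm 0 (-1)) e a;
         rewrite E ee aa eqxx.
    + by case; case: e.
  - case: eqVneq => [_|neq] [].
      by case: e.
    exact: reflect_neq.
  - by case E: rung_or => [e' a'] [ee aa]; have := rung_or_neq (tperm 0 1) e a;
       rewrite E ee aa eqxx.
case: l => [[[[] k]|[d k]]|] //=.
- by case: e; case: ifP.
- case: eqVneq => [//|neq] []; exact: reflect_neq.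
- by case; case: e.
Qed.

Lemma local_step_port y t : local_step (Some (inl y)) (local_port y t) = inr t.
Proof. by case: y t => [[] k] [] /=; rewrite eqxx. Qed.

Lemma local_step_exit l v t : local_step l v = inr t ->
  exists2 y, l = Some (inl y) & v = local_port y t.
Proof.
case: v => [[] [e a]] /=; first by case: l => [[[[] k]|[d k]]|].
case: l => [[[[] k]|[d k]]|] //=.
  by case: e; case: eqP => // -> [<-]; exists (true, k).
by case: eqP => // -> [<-]; exists (false, k).
Qed.

Lemma local_swap_inj : injective local_swap.
Proof. by move=> [[] k] [[] k'] [] //; [move/add_self_inj ->|move->]. Qed.

Lemma local_port_swap y : local_port (local_swap y) true = local_port y false.
Proof. by case: y => [[] k]. Qed.

(** Reflection in the midpoint exchanges [a] and [b]; thus all pairs within one copy of [Q] are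
    adjacent. *)
Lemma local_reflection d e a b : a != b ->
  local_step (Some (inl (false, half (a + b)))) (d, (e, a)) = inl (d, (e, b)).
Proof.
move=> neq; have half_neq : (a == half (a + b)) = false.
  apply: contraNF neq => /eqP aE; apply/eqP/(addrI a).
  by rewrite -[RHS]half2 -aE.
by case: d => /=; rewrite half_neq half2 addrC addKr.
Qed.

Lemma oneN_neq0 : (-1 : Q) != 0.
Proof. by rewrite oppr_eq0 oner_eq0. Qed.

Lemma one_neqN1 : (1 : Q) != -1.
Proof.
rewrite -subr_eq0 opprK; apply: contraTneq unit2 => two0.
by rewrite mulr2n two0 unitr0.
Qed.

Lemma local_complete v u : v != u -> exists l, local_step l v = inl u.
Proof.
have sym (w x : A) : (exists l, local_step l w = inl x) ->
    exists l, local_step l x = inl w.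
  by case=> l /local_stepK; exists l.
have cross e a e' b : exists l, local_step l (false, (e, a)) = inl (true, (e', b)).
  exists (Some (inr (e (+) e', b - a))).
  by rewrite /= addbA addbb addFb addrC subrK.
have ports_rung a b :
    exists l, local_step l (false, (false, a)) = inl (false, (true, b)).
  have [->|neq_ba] := eqVneq a b; first by exists None.
  have [bE|neq_b] := eqVneq b (a + a).
    exists (Some (inl (true, 0))) => /=; rewrite eqxx bE; case: eqVneq => // a0.
    by rewrite bE a0 addr0 eqxx in neq_ba.
  have a_neq : (a == b - a) = false by rewrite eq_sym subr_eq (negPf neq_b).
  have ba_neq0 : (b - a == 0) = false by rewrite subr_eq0 eq_sym (negPf neq_ba).
  by exists (Some (inl (true, b - a))); rewrite /= a_neq ba_neq0 addrC subrK.
have doubled_rung a b :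
    exists l, local_step l (true, (false, a)) = inl (true, (true, b)).
  have [->|neq_ba] := eqVneq a b; first by exists (Some (inl (false, b))); rewrite /= eqxx.
  (* The rung at [a] survives under a transposition fixing [a]: of 1 and -1 for [a = 0], of 0 and -1
     for [a = 1], of 0 and 1 otherwise. *)
  have [->|neq_b] := eqVneq b (a + 1).
    have [->|a_neq0] := eqVneq a 0.
      exists (Some (inl (true, 0))); rewrite /= eqxx /rung_or.
      by rewrite tpermD ?eqxx ?oner_eq0 ?oneN_neq0.
    have [->|a_neq1] := eqVneq a 1.
      exists (Some (inl (true, 1))); rewrite /= oner_eq0 eqxx /rung_or.
      by rewrite tpermD ?eqxx // eq_sym ?oner_eq0 ?one_neqN1.
    by exists None; rewrite /= /rung_or tpermD ?eqxx // eq_sym.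
  have ba_neq1 : (b - a == 1) = false by rewrite subr_eq addrC (negPf neq_b).
  have ba_neq0 : (b - a == 0) = false by rewrite subr_eq0 eq_sym (negPf neq_ba).
  by exists (Some (inl (true, b - a))); rewrite /= ba_neq1 ba_neq0 addrC subrK.
case: v u => [[] [e a]] [[] [e' b]] neq; last first.
- have [ee'|] := eqVneq e e'.
    subst e'; exists (Some (inl (false, half (a + b)))); apply: local_reflection.
    by apply: contra neq => /eqP ->.
  by case: e e' {neq} => [] [] // _; apply: sym; apply: ports_rung.
- exact: cross.
- by apply: sym; apply: cross.
- have [ee'|] := eqVneq e e'.
    subst e'; exists (Some (inl (false, half (a + b)))); apply: local_reflection.
    by apply: contra neq => /eqP ->.
  by case: e e' {neq} => [] [] // _; apply: sym; apply: doubled_rung.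
Qed.

(** Two of the vertices at 0, 1 and -1 have the same value under [f]; each pair of them is joined by
    a reflection and by a transposition. *)
Lemma local_double (f : A -> bool) : exists v u l l',
  [/\ v != u, f v = f u, l != l', local_step l v = inl u & local_step l' v = inl u].
Proof.
pose v a : A := (true, (false, a)).
have rung_swap (x y : Q) : x != y -> rung_or (tperm x y) false x = (false, y).
  by move=> neq; rewrite /rung_or tpermL eq_sym (negPf neq).
have [f01|f01] := eqVneq (f (v 0)) (f (v 1)).
  exists (v 0), (v 1), (Some (inl (false, half (0 + 1)))), None; split=> //.
  - by rewrite xpair_eqE /= xpair_eqE /= eq_sym oner_eq0.
  - by apply: local_reflection; rewrite eq_sym oner_eq0.
  - by rewrite /= rung_swap // eq_sym oner_eq0.
have [f1N|f1N] := eqVneq (f (v 1)) (f (v (-1))).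
  exists (v 1), (v (-1)), (Some (inl (false, half (1 - 1)))), (Some (inl (true, 0))).
  split=> //.
  - by rewrite xpair_eqE /= xpair_eqE /= one_neqN1.
  - by apply: local_reflection; rewrite one_neqN1.
  - by rewrite /= eqxx rung_swap // one_neqN1.
exists (v 0), (v (-1)), (Some (inl (false, half (0 - 1)))), (Some (inl (true, 1))).
split=> //.
- by rewrite xpair_eqE /= xpair_eqE /= eq_sym oneN_neq0.
- by move: f01 f1N; case: (f _); case: (f _); case: (f _).
- by apply: local_reflection; rewrite eq_sym oneN_neq0.
- by rewrite /= oner_eq0 eqxx rung_swap // eq_sym oneN_neq0.
Qed.

Lemma card_local : #|A| = (4 * #|Q|)%N.
Proof. by rewrite !card_prod card_bool mulnA. Qed.

Lemma card_local_index : #|Y| = (2 * #|Q|)%N.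
Proof. by rewrite card_prod card_bool. Qed.

Definition ring_gadget : gadget #|Q| :=
  Gadget card_local card_local_index local_stepK local_step_neq local_step_port
    local_step_exit local_swap_inj local_port_swap local_complete local_double.

End ConcreteGadget.

(** * The circular flow number of the ring graph *)

Lemma ring_graph_flow_ge (R : realType) (p : nat) (A : gadget p)
    (p_gt0 : (0 < p)%N) (D : orientation (ring_graph A p_gt0))
    (f : edge (ring_graph A p_gt0) -> R) (r : R) :
  nowhere_zero_flow r D f ->
  2 + (1 + (#|edge (ring_graph A p_gt0)|.+1)%:R^-1) / p%:R <= r.
Proof.
move=> flow; rewrite leNgt; apply/negP=> r_lt.
pose stepK := @ring_stepK p A p_gt0.
have bound (X : {set ring_vertex A}) :
    `|\sum_(x in X) imbalance D x| *+ (2 * p + 1) <= (\sum_(x in X) step_out X x)%:Z.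
  apply: le_trans (imbalance_bound p_gt0 flow r_lt X) _.
  by rewrite lez_nat; apply: (cut_matching_graph stepK).
(* On a singleton the bound gives [(2p + 1) |b| <= 4p + 1], so [|b| <= 1]; and [b] is odd like the
   degree [4p + 1]. *)
have imbalance1 (x : ring_vertex A) :
    imbalance D x = if imbalance D x == 1 then 1 else -1.
  have := bound [set x]; rewrite !big_set1 => bound_x.
  have : (step_out [set x] x <= (4 * p).+1)%N.
    by apply: leq_trans (max_card _) _; rewrite card_ord.
  have [m mE] := imbalance_parity D x.
  rewrite (degree_matching_graph stepK) card_ord in mE.
  move: bound_x; case: eqP => // + +; move: (imbalance D x) (step_out _ _) mE => b d.
  nia.
apply: (@ring_unbalanced p A p_gt0 (fun x => imbalance D x == 1)) => X.
rewrite (eq_bigr (imbalance D)) => [|x _]; first exact: bound.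
exact/esym/imbalance1.
Qed.

(** All admissible [r] exceed [2 + 1/p] by at least a fixed positive amount, so the infimum does
    too. *)
Lemma ring_graph_flow_number (R : realType) (p : nat) (A : gadget p)
    (p_gt0 : (0 < p)%N) :
  ((2 + p%:R^-1)%:E < circular_flow_number R (ring_graph A p_gt0))%E.
Proof.
pose eps : R := (#|edge (ring_graph A p_gt0)|.+1)%:R^-1.
apply: (@lt_le_trans _ _ (2 + (1 + eps) / p%:R)%:E).
  by rewrite lte_fin ltrD2l mulrDl mul1r ltrDl divr_gt0 ?invr_gt0 ?ltr0n.
apply: le_ereal_inf_tmp => _ [r [_ [D [f flow]]] <-].
by rewrite lee_fin; exact: ring_graph_flow_ge flow.
Qed.

Theorem corollary3p5 (R : realType) (p k : nat)
    (p_ge3 : (3 <= p)%N) (p_odd : odd p) (k_def : k = (2 * p)%N) :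
  exists G : mgraph,
    [/\ regular (2 * k + 1)%N G,
        class1 G &
        ((2 + 2 / k%:R)%R%:E < circular_flow_number R G)%E].
Proof.
have p_gt1 : (1 < p)%N by apply: leq_trans p_ge3.
(* The gadget is built over the integers modulo [p], where 2 is invertible because [p] is odd. *)
have unit2 : (2%:R : 'Z_p) \is a GRing.unit by rewrite unitZpE // coprimen2.
have cardQ : #|'Z_p| = p by rewrite card_ord Zp_cast.
have Q_gt0 : (0 < #|'Z_p|)%N by rewrite cardQ ltnW.
pose A := ring_gadget unit2.
have stepK := ring_stepK (A := A) Q_gt0.
exists (ring_graph A Q_gt0); split.
- move=> v; rewrite (degree_matching_graph stepK) card_ord.
  by rewrite cardQ k_def; lia.
- by apply: (class1_matching_graph stepK); apply/card_gt0P; exists (hub A).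
- have -> : (2 / k%:R = #|'Z_p|%:R^-1 :> R)%R; last exact: ring_graph_flow_number.
  by rewrite cardQ k_def natrM invfM mulrA divff ?mul1r // pnatr_eq0.
Qed.
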